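(* Let $(S_n)_{n\ge 0}$ be a tampered memory elephant random walk (TMERW) with parameters $p,\lambda$ and memory sets $\mathcal{D}=(D_n)_{n\ge1}$, where $0\le p<1$ and $0\le\lambda\le 1$. Suppose that $\frac{|D_n|}{n}\to 0$ almost surely as $n\to\infty$ (the sequence $\mathcal{D}$ is not assumed to be nested or monotone in any way). Then $$\frac{S_n}{n}\longrightarrow 0\quad\text{almost surely as } n\to\infty .$$
   Context: TMERW: Fix $p,\lambda\in[0,1]$. Let $\mathcal{D}=(D_n)_{n\ge1}$ be a sequence of (deterministic or random) sets with $D_n\subseteq\{1,\dots,n\}$, and let $D_n^c=\{1,\dots,n\}\setminus D_n$; $|D_n|$ denotes cardinality. Let $X_1$ be a random variable with values in $\{-1,+1\}$ (arbitrary law); let $(Y_n)_{n\ge2}$ be i.i.d. with $P(Y_n=1)=1-P(Y_n=-1)=\lambda$ (the innovations); let $(\varepsilon_n)_{n\ge2}$ be i.i.d. with $P(\varepsilon_n=1)=1-P(\varepsilon_n=-1)=p$; let $(I_{n+1})_{n\ge1}$ be independent with $I_{n+1}$ uniform on $\{1,\dots,n\}$. The objects $X_1$, $\mathcal{D}$, $(Y_n)$, $(\varepsilon_n)$, $(I_n)$ are mutually independent. For $n\ge1$ define recursively $X_{n+1}=\varepsilon_{n+1}X_{I_{n+1}}$ if $I_{n+1}\notin D_n$, and $X_{n+1}=Y_{n+1}$ if $I_{n+1}\in D_n$. The TMERW is $S_0=0$, $S_n=X_1+\dots+X_n$. *)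

(* Defs.v *)
From HB Require Import structures.
From mathcomp Require Import all_boot all_order all_algebra finmap.
From mathcomp Require Import all_classical all_reals all_analysis.

Set Implicit Arguments.
Unset Strict Implicit.
Unset Printing Implicit Defensive.

Import Order.TTheory GRing.Theory Num.Theory.
Import numFieldNormedType.Exports.

Local Open Scope classical_set_scope.
Local Open Scope ring_scope.

(* [{fset nat}] is countable, so a random finite set is a map into it that is
   measurable for the discrete sigma-algebra. *)
HB.instance Definition _ := isPointed.Build {fset nat} fset0.
HB.instance Definition _ := @isMeasurable.Build default_measure_display
  {fset nat} discrete_measurable discrete_measurable0
  discrete_measurableC discrete_measurableU.

(* The sigma-algebra on [T] generated by the random elements [Z n], [n \in K];
   indices outside [K] carry no meaning and are left out. *)
Definition sigma_gen d d' (T : measurableType d) (V : measurableType d')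
    (K : set nat) (Z : nat -> T -> V) : set_system T :=
  <<s \bigcup_(n in K) preimage_set_system [set: T] (Z n) measurable >>.

Definition mutually_independent d (T : measurableType d) (R : realType)
    (P : probability T R) (J : choiceType) (K : set J)
    (F : J -> set_system T) : Prop :=
  forall (B : {fset J}) (A : J -> set T),
    [set` B] `<=` K ->
    (forall i, i \in B -> F i (A i)) ->
    P (\bigcap_(i in [set` B]) A i) = (\prod_(i <- B) P (A i))%E.

Definition independent_seq d d' (T : measurableType d) (V : measurableType d')
    (R : realType) (P : probability T R) (K : set nat) (Z : nat -> T -> V) :
    Prop :=
  mutually_independent P K (fun n => sigma_gen [set n] Z).

(* The time indices follow the usual convention: [tm_X n] and [D n] are meaningful for [n >= 1], and [tm_Y n],
   [tm_eps n], [tm_I n] for [n >= 2]. *)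
Record tmerw d (T : measurableType d) (R : realType) (P : probability T R)
    (p lam : R) (D : nat -> {RV P >-> {fset nat}}) := Tmerw {
  tm_X : nat -> {RV P >-> R} ;
  tm_Y : nat -> {RV P >-> R} ;
  tm_eps : nat -> {RV P >-> R} ;
  tm_I : nat -> {RV P >-> nat} ;

  tm_D_sub : forall n w k, (1 <= n)%N -> k \in D n w -> (1 <= k <= n)%N ;

  tm_X1_pm1 : forall w, tm_X 1 w = 1 \/ tm_X 1 w = -1 ;

  tm_Y_indep : independent_seq P [set n | (2 <= n)%N] tm_Y ;
  tm_Y_law : forall n, (2 <= n)%N ->
    P [set w | tm_Y n w = 1] = lam%:E /\ P [set w | tm_Y n w = -1] = (1 - lam)%:E ;

  tm_eps_indep : independent_seq P [set n | (2 <= n)%N] tm_eps ;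
  tm_eps_law : forall n, (2 <= n)%N ->
    P [set w | tm_eps n w = 1] = p%:E /\ P [set w | tm_eps n w = -1] = (1 - p)%:E ;

  tm_I_range : forall n w, (1 <= n)%N -> (1 <= tm_I n.+1 w <= n)%N ;
  tm_I_indep : independent_seq P [set n | (2 <= n)%N] tm_I ;
  tm_I_law : forall n k, (1 <= k <= n)%N ->
    P [set w | tm_I n.+1 w = k] = (n%:R^-1)%:E ;

  tm_all_indep : mutually_independent P [set: 'I_5]
    (fun i => nth set0
      [:: sigma_gen [set 1%N] tm_X;
          sigma_gen [set n | (1 <= n)%N] D;
          sigma_gen [set n | (2 <= n)%N] tm_Y;
          sigma_gen [set n | (2 <= n)%N] tm_eps;
          sigma_gen [set n | (2 <= n)%N] tm_I] i) ;

  tm_X_step : forall n w, (1 <= n)%N ->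
    tm_X n.+1 w = if tm_I n.+1 w \in D n w then tm_Y n.+1 w
                  else tm_eps n.+1 w * tm_X (tm_I n.+1 w) w }.

Definition tmerw_walk d (T : measurableType d) (R : realType)
    (P : probability T R) (p lam : R) (D : nat -> {RV P >-> {fset nat}})
    (W : tmerw p lam D) (n : nat) (w : T) : R :=
  \sum_(1 <= k < n.+1) tm_X W k w.

(* Main.v *)
Require Import Defs.
From HB Require Import structures.
From mathcomp Require Import all_boot all_order all_algebra finmap.
From mathcomp Require Import all_classical all_reals all_analysis.
From mathcomp Require Import measurable_realfun.
From mathcomp Require Import zify ring lra.

Set Implicit Arguments.
Unset Strict Implicit.
Unset Printing Implicit Defensive.

Import Order.TTheory GRing.Theory Num.Theory.
Import numFieldNormedType.Exports.

Local Open Scope classical_set_scope.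
Local Open Scope ring_scope.

(* Let [a = 2p - 1 < 1]. The walk solves [S_(n+1) = S_n + a S_n / n + r_n + xi_n],
   where [|r_n| <= 2 |D_n| / n] and [xi_n] is [X_(n+1)] minus its mean given the
   past and the memory sets. Writing [xi_n] as a sum of terms
   [g (1_A - P A)], with [g] a function of the past and [A] an event on the draw
   at time [n+1], the noise [N_n = xi_1 + ... + xi_(n-1)] has
   [E(N_n xi_n) = 0] by independence; since the past takes countably many values,
   conditioning on it is a sum over its fibers. Hence [E(N_n ^ 2) = O(n)] and
   [N_n / n --> 0] almost surely. Finally [U = S - N] satisfies
   [U_(n+1) = (1 + a / n) U_n + o(1)], and divergence of the harmonic series
   forces [U_n / n --> 0] because [a < 1]. *)

(** * Linear recursions and divergence of the harmonic series *)

(** If [u] stayed nonnegative, telescoping the descent would bound [c] times the harmonic sums from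
    [n0] on by [u n0], and the harmonic series would converge. *)
Lemma harmonic_descent_unbounded (R : realType) (c : R) (u : nat -> R) n0 :
  0 < c -> (forall n, (n0 <= n)%N -> u n.+1 <= u n - c * n.+1%:R^-1) ->
  exists2 n, (n0 <= n)%N & u n < 0.
Proof.
move=> c0 hu; apply: contrapT => hN.
have u0 n : (n0 <= n)%N -> 0 <= u n.
  by move=> nn; rewrite leNgt; apply/negP => un; apply: hN; exists n.
apply: (@dvg_harmonic R).
have hle k : c * (\sum_(n0 <= i < n0 + k) i.+1%:R^-1) <= u n0 - u (n0 + k)%N.
  elim: k => [|k IH]; first by rewrite addn0 big_geq// mulr0 subrr.
  rewrite addnS big_nat_recr ?leq_addr//= mulrDr.
  have := hu (n0 + k)%N (leq_addr _ _).
  by move: IH; set x := c * _; set y := c * _; lra.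
apply: nondecreasing_is_cvgn.
  by apply/nondecreasing_seqP => n; rewrite seriesSr lerDl harmonic_ge0.
exists (series harmonic n0 + u n0 / c) => _ [n _ <-].
have nd : {homo (series (@harmonic R)) : a b / (a <= b)%N >-> a <= b}.
  by apply/nondecreasing_seqP => m; rewrite seriesSr lerDl harmonic_ge0.
apply: le_trans (nd _ _ (leq_addl n0 n)) _.
rewrite /series/= (big_cat_nat (n := n0)) ?leq_addr//= lerD2l.
rewrite ler_pdivlMr// mulrC; apply: le_trans (hle n) _.
by rewrite lerBlDr lerDl u0 ?leq_addr.
Qed.

(** Take [u n = |U n| / n], [c = 1 - a]. As long as [u n] exceeds [e], each step lowers it by at
    least [c * h / (n + 1)], so divergence of the harmonic series brings it below [e]. From there it
    cannot leave: the next value is at most a weighted average of [u n] and [h], both at most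
    [e]. *)
Lemma perturbed_contraction_cvg0 (R : realType) (a : R) (U delta : nat -> R) :
  -1 <= a < 1 ->
  (forall n, (1 <= n)%N -> U n.+1 = (1 + a / n%:R) * U n + delta n) ->
  delta @ \oo --> (0 : R) ->
  (fun n => U n / n%:R) @ \oo --> (0 : R).
Proof.
move=> /andP[a1 a2] hU hd; apply/cvgr0Pnorm_le => e e0.
(* Half of [e], so that [u n > e] leaves a net decrease [c * (e - h) = c * h]. *)
pose h := e / 2; have h0 : 0 < h by rewrite divr_gt0.
pose c := 1 - a; have c0 : 0 < c by rewrite subr_gt0.
have [n1 _ hn1] : \forall n \near \oo, `|delta n| <= c * h.
  by move/cvgr0Pnorm_le : hd; apply; rewrite mulr_gt0.
pose n0 := n1.+1; pose u n := `|U n| / n%:R.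
have hu n : (n0 <= n)%N -> n.+1%:R * u n.+1 <= (n.+1%:R - c) * u n + c * h.
  move=> nn; have n_gt0 : (0 < n)%N by apply: leq_trans nn.
  have nR : 0 < n%:R :> R by rewrite ltr0n.
  have n1R : 1 <= n%:R :> R by rewrite ler1n.
  rewrite /u mulrCA mulfV ?pnatr_eq0// mulr1 hU//.
  apply: le_trans (ler_normD _ _) _; apply: lerD; last first.
    by apply: hn1 => /=; apply: ltnW.
  rewrite normrM ger0_norm; last first.
    rewrite -[X in X + _](@mulfV _ n%:R) ?gt_eqF// -mulrDl.
    by apply: divr_ge0; [move: n1R; set x := n%:R; lra|exact: ltW].
  rewrite /c -natr1 le_eqVlt; apply/orP; left; apply/eqP; field.
  by rewrite gt_eqF.
have [m nm um] : exists2 m, (n0 <= m)%N & u m <= e.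
  apply: contrapT => hN.
  have big n : (n0 <= n)%N -> e < u n.
    by move=> nn; rewrite ltNge; apply/negP => un; apply: hN; exists n.
  have [||n nn] := @harmonic_descent_unbounded R (c * h) u n0.
  - by rewrite mulr_gt0.
  - move=> n nn; have := hu n nn; have := big n nn => b1 b2.
    have nR : 0 < n.+1%:R :> R by rewrite ltr0n.
    rewrite -(ler_pM2l nR) mulrBr.
    have -> : n.+1%:R * (c * h * n.+1%:R^-1) = c * h by field; rewrite gt_eqF.
    have : c * e <= c * u n by rewrite ler_pM2l// ltW.
    have -> : c * e = c * h + c * h by rewrite /h; field.
    by move: b2; set x := n.+1%:R; set y := u n; set z := u n.+1; lra.
  - by rewrite ltNge divr_ge0.
have small k : u (m + k)%N <= e.
  elim: k => [|k IH]; first by rewrite addn0.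
  have nmk : (n0 <= m + k)%N by rewrite (leq_trans nm)// leq_addr.
  have := hu _ nmk; rewrite addnS.
  have nR : 0 < (m + k).+1%:R :> R by rewrite ltr0n.
  have n1R : 1 <= (m + k)%:R :> R by rewrite ler1n (leq_trans _ nmk).
  move=> b; rewrite -(ler_pM2l nR); apply: le_trans b _.
  have k0 : 0 <= (m + k).+1%:R - c by rewrite /c -natr1; lra.
  have := ler_wpM2l k0 IH.
  have : c * h <= c * e by rewrite ler_pM2l// /h; lra.
  nra.
near=> n.
rewrite normrM normfV [X in _ / X]ger0_norm ?ler0n//.
have -> : n = (m + (n - m))%N by rewrite subnKC//; near: n; exists m.
exact: small.
Unshelve. all: by end_near.
Qed.

(** Splitting [a * (S n / n)] along [S = (S - N) + N] moves [a * (N n / n)] into the vanishing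
    perturbation of a recursion for [S - N]. *)
Lemma tampered_recursion_cvg0 (R : realType) (a : R) (S N r : nat -> R) :
  -1 <= a < 1 ->
  (forall n, (1 <= n)%N ->
    S n.+1 = S n + a * (S n / n%:R) + r n + (N n.+1 - N n)) ->
  r @ \oo --> (0 : R) ->
  (fun n => N n / n%:R) @ \oo --> (0 : R) ->
  (fun n => S n / n%:R) @ \oo --> (0 : R).
Proof.
move=> ha hS hr hN.
have hU : (fun n => (S n - N n) / n%:R) @ \oo --> (0 : R).
  apply: (@perturbed_contraction_cvg0 _ a _ (fun n => a * (N n / n%:R) + r n)) => //.
    by move=> n n1; rewrite hS//; ring.
  have -> : (0 : R) = a * 0 + 0 by ring.
  by apply: cvgD => //; apply: cvgMr.
have -> : (0 : R) = 0 + 0 by ring.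
rewrite (_ : (fun n => S n / n%:R) =
  (fun n => (S n - N n) / n%:R) \+ (fun n => N n / n%:R)); first exact: cvgD.
by apply/funext => n /=; ring.
Qed.

(** * A strong law from linear second moments *)

(** From [k ^ 2] to any [n < (k + 1) ^ 2] there are at most [2 * k] steps of size at most [K], and
    [2 * K * k] is negligible against [k ^ 2]. *)
Lemma cvg0_of_squares (R : realType) (K : R) (N : nat -> R) :
  (forall n, `|N n.+1 - N n| <= K) ->
  (fun k => N (k ^ 2)%N / (k ^ 2)%:R) @ \oo --> (0 : R) ->
  (fun n => N n / n%:R) @ \oo --> (0 : R).
Proof.
move=> hK hN; apply/cvgr0Pnorm_le => e e0.
have K0 : 0 <= K by apply: le_trans (hK 0%N).
have lip n m : `|N (n + m)%N - N n| <= K * m%:R.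
  elim: m => [|m IH]; first by rewrite addn0 subrr normr0 mulr0.
  rewrite addnS -natr1 mulrDr mulr1.
  have -> : N (n + m).+1 - N n = (N (n + m)%N - N n) + (N (n + m).+1 - N (n + m)%N).
    by ring.
  by apply: le_trans (ler_normD _ _) _; apply: lerD.
have e20 : 0 < e / 2 by rewrite divr_gt0.
have [k0 _ hk0] : \forall k \near \oo, `|N (k ^ 2)%N / (k ^ 2)%:R| <= e / 2.
  by move/cvgr0Pnorm_le : hN; apply.
(* Beyond this threshold [K * (2 * k) <= e / 2 * k ^ 2]. *)
have [k1 hk1] : exists k1 : nat, K * 2 / (e / 2) <= k1%:R.
  by exists (Num.truncn (K * 2 / (e / 2))).+1; rewrite ltW// truncnS_gt.
pose k2 := (maxn k0 k1).+1.
exists (k2 ^ 2)%N => // n /= hn.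
have [k [kn nk]] : exists k, (k ^ 2 <= n)%N /\ (n < k.+1 ^ 2)%N.
  elim: (n) => [|m [k [km mk]]]; first by exists 0%N.
  have [h|h] := ltnP m.+1 (k.+1 ^ 2).
    by exists k; split => //; apply: leqW.
  by exists k.+1; split => //; move: mk; rewrite -!mulnn; lia.
have k2k : (k2 <= k)%N.
  by rewrite -ltnS -(ltn_sqr) (leq_ltn_trans hn).
have k_gt0 : (0 < k)%N by apply: leq_trans k2k.
have kR : 0 < k%:R :> R by rewrite ltr0n.
have k2R : 0 < (k ^ 2)%:R :> R by rewrite ltr0n expn_gt0 k_gt0.
have nR : 0 < n%:R :> R by rewrite ltr0n (leq_trans _ kn)// expn_gt0 k_gt0.
have knR : (k ^ 2)%:R <= n%:R :> R by rewrite ler_nat.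
have b1 : `|N (k ^ 2)%N| <= e / 2 * (k ^ 2)%:R.
  have kk : (k0 <= k)%N.
    by apply: leq_trans k2k; rewrite /k2 leqW// leq_maxl.
  by have := hk0 _ kk; rewrite normrM normfV (gtr0_norm k2R) ler_pdivrMr.
have b2 : K * (n - k ^ 2)%:R <= e / 2 * (k ^ 2)%:R.
  have kk : (k1%:R <= k%:R :> R).
    by rewrite ler_nat; apply: leq_trans k2k; rewrite /k2 leqW// leq_maxr.
  have := le_trans hk1 kk; rewrite ler_pdivrMr// => b.
  have h : (n - k ^ 2)%:R <= 2 * k%:R :> R.
    by rewrite -natrM ler_nat; move: nk; rewrite -!mulnn; lia.
  apply: le_trans (ler_wpM2l K0 h) _.
  by rewrite natrX mulrA expr2; have := ler_wpM2l (ltW kR) b; nra.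
rewrite normrM normfV (gtr0_norm nR) ler_pdivrMr//.
have -> : N n = N (k ^ 2)%N + (N (k ^ 2 + (n - k ^ 2))%N - N (k ^ 2)%N).
  by rewrite subnKC//; ring.
apply: le_trans (ler_normD _ _) _.
have := lip (k ^ 2)%N (n - k ^ 2)%N.
nra.
Qed.

Lemma sum_inv_squares_le2 (R : realType) n :
  \sum_(0 <= k < n) ((k.+1 ^ 2)%:R : R)^-1 <= 2.
Proof.
case: n => [|n]; first by rewrite big_geq.
(* The bound is strengthened so that the induction telescopes, through
   [1 / (x + 1) ^ 2 <= 1 / x - 1 / (x + 1)]. *)
suff : \sum_(0 <= k < n.+1) ((k.+1 ^ 2)%:R : R)^-1 <= 2 - (n.+1%:R)^-1.
  by move=> h; apply: le_trans h _; rewrite gerBl invr_ge0.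
elim: n => [|n IH]; first by rewrite big_nat1 exp1n invr1; lra.
rewrite big_nat_recr//=; apply: le_trans (lerD IH (lexx _)) _.
rewrite -addrA lerD2l natrX -[n.+2%:R]natr1; set x := n.+1%:R.
have x0 : 0 < x by rewrite ltr0n.
rewrite -subr_ge0.
have -> : - (x + 1)^-1 - (- x^-1 + ((x + 1) ^+ 2)^-1) = (x * (x + 1) ^+ 2)^-1.
  by field; rewrite !gt_eqF// addr_gt0.
by rewrite invr_ge0 mulr_ge0 ?sqr_ge0// ltW.
Qed.

Lemma nneseries_fin_num_cvg0 (R : realType) (x : nat -> R) :
  (forall k, 0 <= x k) -> (\sum_(k <oo) (x k)%:E \is a fin_num)%E ->
  x @ \oo --> (0 : R).
Proof.
move=> x0 xfin; apply: cvg_series_cvg_0.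
apply: nondecreasing_is_cvgn.
  by apply/nondecreasing_seqP => n; rewrite seriesSr lerDl.
exists (fine (\sum_(k <oo) (x k)%:E)%E) => _ [n _ <-].
rewrite -lee_fin fineK// /series/= -sumEFin.
by apply: nneseries_lim_ge => k _ _; rewrite lee_fin.
Qed.

(* The second moments make [N (k ^ 2) / k ^ 2] square summable almost surely;
   bounded increments control the walk between consecutive squares. *)
Lemma linear_second_moment_slln d (T : measurableType d) (R : realType)
    (P : probability T R) (Om : set T) (N : nat -> T -> R) (C K : R) :
  measurable Om -> (forall n, measurable_fun Om (N n)) ->
  (forall n w, Om w -> `|N n.+1 w - N n w| <= K) ->
  (forall n, (\int[P]_(w in Om) (N n w ^+ 2)%:E <= (C * n%:R)%:E)%E) ->
  {ae P, forall w, Om w -> (fun n => N n w / n%:R) @ \oo --> (0 : R)}.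
Proof.
move=> mOm mN hK hC.
(* The index is shifted to [k.+1] so that no denominator vanishes. *)
pose y k w : R := N (k.+1 ^ 2)%N w / (k.+1 ^ 2)%:R.
pose f k w : \bar R := (y k w ^+ 2)%:E.
have C0 : 0 <= C.
  have := hC 1%N; rewrite mulr1 => h; rewrite -lee_fin; apply: le_trans h.
  by apply: integral_ge0 => w _; rewrite lee_fin sqr_ge0.
have f0 k w : Om w -> (0 <= f k w)%E by rewrite lee_fin sqr_ge0.
have mf k : measurable_fun Om (f k).
  apply/measurable_EFinP; apply: measurable_funX; apply: measurable_funM => //.
have If k : (\int[P]_(w in Om) f k w <= (C * ((k.+1 ^ 2)%:R)^-1)%:E)%E.
  pose s : R := (k.+1 ^ 2)%:R; have s0 : 0 < s by rewrite ltr0n expn_gt0.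
  under eq_integral do rewrite /f /y exprMn mulrC EFinM.
  rewrite ge0_integralZl_EFin//; last 2 first.
  - by move=> w _; rewrite lee_fin sqr_ge0.
  - by apply/measurable_EFinP; apply: measurable_funX.
  have -> : (C * s^-1)%:E = ((s^-1 ^+ 2)%:E * (C * s)%:E)%E.
    by rewrite -EFinM; congr EFin; field; rewrite gt_eqF.
  by rewrite lee_pmul2l ?lte_fin ?exprn_gt0 ?invr_gt0//; exact: hC.
(* Integrating the nonnegative series term by term gives at most [2 * C]; the series is therefore
   finite almost everywhere on [Om] and its terms tend to 0. *)
have fint : P.-integrable Om (fun w => \sum_(k <oo) f k w)%E.
  apply/integrableP; split.
    by apply: ge0_emeasurable_sum => // k w Ow _; exact: f0.
  under eq_integral => w /set_mem Ow.
    rewrite gee0_abs; last by apply: nneseries_ge0 => k _ _; exact: f0.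
    over.
  rewrite integral_nneseries//.
  apply: (@le_lt_trans _ _ (C * 2)%:E); last exact: ltry.
  apply: lime_le.
    by apply: is_cvg_nneseries => k _ _; apply: integral_ge0 => w; exact: f0.
  apply: nearW => n; apply: le_trans (lee_sum _ (fun k _ => If k)) _.
  rewrite sumEFin lee_fin -mulr_sumr ler_wpM2l//.
  exact: sum_inv_squares_le2.
have := integrable_ae mOm fint; apply: filterS => w hw Ow.
apply: (@cvg0_of_squares _ K) => [n|]; first exact: hK.
have y2 : (fun k => y k w ^+ 2) @ \oo --> (0 : R).
  by apply: nneseries_fin_num_cvg0 => [k|]; [exact: sqr_ge0|exact: hw].
rewrite -cvg_shiftS/=; apply/cvgr0Pnorm_le => e e0.
have e2 : 0 < e ^+ 2 by rewrite exprn_gt0.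
move/cvgr0Pnorm_le : y2 => /(_ _ e2); apply: filterS => k.
by rewrite normrX ler_pXn2r// nnegrE ltW.
Qed.

(** * Orthogonality on fibers and growth of second moments *)

Lemma bounded_integrable d (T : measurableType d) (R : realType)
    (P : probability T R) (Om : set T) (f : T -> R) (M : R) :
  measurable Om -> measurable_fun Om f -> (forall w, Om w -> `|f w| <= M) ->
  P.-integrable Om (EFin \o f).
Proof.
move=> mOm mf fM; apply: measurable_bounded_integrable => //.
  by rewrite (le_lt_trans (probability_le1 _ _))// ltry.
exists M; split; first exact: num_real.
by move=> x Mx w Ow; apply: le_trans (fM _ Ow) (ltW Mx).
Qed.

(** On each fiber of [H] in [Om], [Z] is constant and factors out, and what remains is
    [P (A and fiber) - q * P fiber = 0]. Countability of [V] turns the integral into the sum of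
    these fiber integrals, so no conditional expectation is needed. *)
Lemma integral_centered_indep d (T : measurableType d) (R : realType)
    (P : probability T R) (Om A : set T) (V : countType) (H : T -> V)
    (Z : T -> R) (q M : R) :
  measurable Om -> measurable A -> (forall v, measurable (H @^-1` [set v])) ->
  measurable_fun Om Z -> (forall w, Om w -> `|Z w| <= M) ->
  (forall w w', Om w -> Om w' -> H w = H w' -> Z w = Z w') ->
  (forall v, P (A `&` (Om `&` H @^-1` [set v])) =
    (q%:E * P (Om `&` H @^-1` [set v]))%E) ->
  (\int[P]_(w in Om) (Z w * (\1_A w - q))%:E = 0)%E.
Proof.
move=> mOm mA mH mZ ZM ZH hA.
(* Fibers are indexed by the natural number coding their value, with an empty set at each code that
   is not attained. *)
pose F k := Om `&` [set w | choice.pickle (H w) = k].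
have FE w : Om `&` [set w' | choice.pickle (H w') = choice.pickle (H w)] =
    Om `&` H @^-1` [set H w].
  apply/seteqP; split => w' /= [Ow' e]; split => //; last by rewrite e.
  exact: pcan_inj (@choice.pickleK V) _ _ e.
have mF k : measurable (F k).
  have [[w [_ wk]]|F0] := pselect (exists w, F k w).
    by rewrite /F -wk FE; exact: measurableI.
  rewrite (_ : F k = set0); first exact: measurable0.
  by apply/seteqP; split => // w Fw; apply: F0; exists w.
have OmF : Om = \bigcup_k F k.
  by apply/seteqP; split => [w Ow|w [k _ []]//]; exists (choice.pickle (H w)).
have mI : measurable_fun Om (fun w => \1_A w - q : R).
  by apply: measurable_funB => //; exact: measurable_indic.
have I_le (w : T) : `|\1_A w - q : R| <= 1 + `|q|.
  apply: le_trans (ler_normB _ _) _; rewrite lerD2r indicE.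
  by case: (w \in A); rewrite ?normr1 ?normr0.
have int0 : P.-integrable Om (fun w => (Z w * (\1_A w - q))%:E).
  apply: (@bounded_integrable _ _ _ _ _ _ (M * (1 + `|q|))) => //.
    exact: measurable_funM.
  by move=> w Ow; rewrite normrM ler_pM// ZM.
rewrite {1}OmF integral_bigcup//; last 2 first.
- apply/trivIsetP => i j _ _ /eqP ij; apply/seteqP; split => // w /= [[_ wi] [_ wj]].
  by apply: ij; rewrite -wi -wj.
- by rewrite -OmF.
apply: eseries0 => k _ _.
have [[w [Ow wk]]|F0] := pselect (exists w, F k w); last first.
  rewrite (_ : F k = set0) ?integral_set0//.
  by apply/seteqP; split => // w Fw; apply: F0; exists w.
have FkE : F k = Om `&` H @^-1` [set H w] by rewrite -FE -wk.
have -> : (\int[P]_(x in F k) (Z x * (\1_A x - q))%:E =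
    \int[P]_(x in F k) ((Z w)%:E * (\1_A x - q)%:E))%E.
  apply: eq_integral => x; rewrite FkE => /set_mem[Ox Hx].
  by rewrite -EFinM (ZH x w).
have i1 : P.-integrable (F k) (EFin \o (\1_A : T -> R)).
  apply: (@bounded_integrable _ _ _ _ _ _ 1) => //.
  by move=> x _; rewrite indicE; case: (x \in A); rewrite ?normr1 ?normr0.
have iq : P.-integrable (F k) (EFin \o cst q).
  exact: (@bounded_integrable _ _ _ _ _ _ `|q|).
rewrite integralZl//; last first.
  apply: (@bounded_integrable _ _ _ _ _ (fun x => \1_A x - q) (1 + `|q|)) => //.
  by apply: measurable_funS mI => // x [].
suff -> : (\int[P]_(x in F k) (\1_A x - q)%:E = 0)%E by rewrite mule0.
have := @integralB_EFin _ _ _ P _ _ _ (mF k) i1 iq => /= ->.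
rewrite integral_indic// integral_cst//= FkE hA.
by rewrite subee// fin_numM// fin_num_measure//; exact: measurableI.
Qed.

(** In the expansion of the square of [N n + (N n.+1 - N n)] the cross term integrates to 0, so each
    step adds at most [K ^ 2]. *)
Lemma orthogonal_increments_second_moment d (T : measurableType d)
    (R : realType) (P : probability T R) (Om : set T) (N : nat -> T -> R)
    (K : R) :
  measurable Om -> (forall n, measurable_fun Om (N n)) ->
  (forall w, N 0%N w = 0) ->
  (forall n w, Om w -> `|N n.+1 w - N n w| <= K) ->
  (forall n, \int[P]_(w in Om) (N n w * (N n.+1 w - N n w))%:E = 0)%E ->
  forall n, (\int[P]_(w in Om) (N n w ^+ 2)%:E <= (K ^+ 2 * n%:R)%:E)%E.
Proof.
move=> mOm mN N0 hK orth.
have NK n w : Om w -> `|N n w| <= K * n%:R.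
  move=> Ow; elim: n => [|n IH]; first by rewrite N0 normr0 mulr0.
  have -> : N n.+1 w = N n w + (N n.+1 w - N n w) by ring.
  by rewrite -natr1 mulrDr mulr1 (le_trans (ler_normD _ _))// lerD// hK.
have iN n : P.-integrable Om (EFin \o (fun w => N n w ^+ 2)).
  apply: (@bounded_integrable _ _ _ _ _ _ ((K * n%:R) ^+ 2)) => //.
    exact: measurable_funX.
  by move=> w Ow; rewrite normrX lerXn2r ?nnegrE ?NK// (le_trans _ (NK n w Ow)).
have iD n : P.-integrable Om (EFin \o (fun w => N n w * (N n.+1 w - N n w))).
  apply: (@bounded_integrable _ _ _ _ _ _ (K * n%:R * K)) => //.
    by apply: measurable_funM => //; exact: measurable_funB.
  by move=> w Ow; rewrite normrM ler_pM ?NK ?hK.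
have iK : P.-integrable Om (EFin \o cst (K ^+ 2)).
  exact: (@bounded_integrable _ _ _ _ _ _ `|K ^+ 2|).
elim=> [|n IH].
  under eq_integral do rewrite N0 expr0n/=.
  by rewrite integral0 mulr0.
have iNK := integrableD mOm (iN n) iK.
have i2D := integrableZl mOm 2 (iD n).
pose a w := N n w ^+ 2; pose b w := N n w * (N n.+1 w - N n w).
apply: (@le_trans _ _ (\int[P]_(w in Om)
    (((EFin \o a) \+ (EFin \o cst (K ^+ 2)%R)) w + 2%:E * (EFin \o b) w))%E).
  apply: le_integral => //; [exact: iN|exact: (integrableD mOm iNK i2D)|].
  move=> w /set_mem Ow /=; rewrite -EFinM -!EFinD lee_fin /a /b.
  have : (N n.+1 w - N n w) ^+ 2 <= K ^+ 2.
    by rewrite -real_normK ?num_real// lerXn2r ?nnegrE ?hK// (le_trans _ (hK n w Ow)).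
  nra.
have orthb : (\int[P]_(w in Om) (EFin \o b) w = 0)%E by exact: orth.
have iDb : P.-integrable Om (EFin \o b) by exact: iD.
rewrite integralD// (integralZl mOm iDb) orthb mule0 adde0.
rewrite integralD_EFin//; last exact: iN.
rewrite -natr1 mulrDr mulr1 EFinD leeD//.
have -> : (\int[P]_(w in Om) (EFin \o cst (K ^+ 2)%R) w = (K ^+ 2)%:E * P Om)%E.
  exact: (integral_cst P mOm (K ^+ 2)%:E).
rewrite -[leRHS]mule1; apply: lee_wpmul2l; last exact: probability_le1.
by rewrite lee_fin sqr_ge0.
Qed.

(** * Product formulas for the independent sources *)

Lemma sigma_gen_preimage d d' (T : measurableType d) (V : measurableType d')
    (K : set nat) (Z : nat -> T -> V) n (B : set V) :
  K n -> measurable B -> sigma_gen K Z (Z n @^-1` B).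
Proof.
move=> Kn mB; apply: sub_sigma_algebra; exists n => //.
by exists B => //; rewrite setTI.
Qed.

Lemma sigma_gen_setI d d' (T : measurableType d) (V : measurableType d')
    (K : set nat) (Z : nat -> T -> V) (A B : set T) :
  sigma_gen K Z A -> sigma_gen K Z B -> sigma_gen K Z (A `&` B).
Proof. exact: (@measurableI _ (g_sigma_algebraType _)). Qed.

Lemma sigma_gen_forall d d' (T : measurableType d) (V : measurableType d')
    (K J : set nat) (Z : nat -> T -> V) (B : nat -> set V) :
  J `<=` K -> (forall k, measurable (B k)) ->
  sigma_gen K Z [set w | forall k, J k -> B k (Z k w)].
Proof.
move=> JK mB.
rewrite (_ : [set w | _] = \bigcap_k (if k \in J then Z k @^-1` B k else setT)).
  apply: (@bigcapT_measurable _ (g_sigma_algebraType _)) => k.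
  case: ifPn => [/set_mem Jk|_]; last exact: measurableT.
  by apply: sigma_gen_preimage => //; exact: JK.
apply/seteqP; split => w /= hw k.
  by move=> _; case: ifPn => [/set_mem/hw|].
by move=> Jk; have := hw k I; rewrite mem_set.
Qed.

(** The product formula is applied to the indices [2..n] and to the same indices with [n.+1] added;
    the two products differ by one factor. *)
Lemma independent_seq_next d d' (T : measurableType d) (V : measurableType d')
    (R : realType) (P : probability T R) (Z : nat -> T -> V)
    (B : nat -> set V) (C : set V) n :
  independent_seq P [set k | (2 <= k)%N] Z -> (1 <= n)%N ->
  (forall k, measurable (B k)) -> measurable C ->
  P ([set w | forall k, (2 <= k <= n)%N -> B k (Z k w)] `&` Z n.+1 @^-1` C) =
  (P [set w | forall k, (2 <= k <= n)%N -> B k (Z k w)] * P (Z n.+1 @^-1` C))%E.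
Proof.
move=> indep n1 mB mC.
pose F := [fset k in iota 2 n.-1]%fset.
have FE k : (k \in F) = (2 <= k <= n)%N.
  by rewrite !inE mem_iota; apply/idP/idP; lia.
(* One family serves both index sets: constraints of the past up to [n], the new event after it. *)
pose A k := if (k <= n)%N then Z k @^-1` B k else Z k @^-1` C.
have sA k : sigma_gen [set k] Z (A k).
  by rewrite /A; case: ifP => _; apply: sigma_gen_preimage.
have AF : \bigcap_(i in [set` F]) A i =
    [set w | forall k, (2 <= k <= n)%N -> B k (Z k w)].
  apply/seteqP; split => w /= hw k.
    move=> kn; have := hw k; rewrite /= FE => /(_ kn).
    by rewrite /A; move: kn => /andP[_ ->].
  by rewrite /= FE => kn; rewrite /A; move: (kn) => /andP[_ ->]; exact: hw.
have nF : n.+1 \notin F by rewrite FE ltnn andbF.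
have AS : A n.+1 = Z n.+1 @^-1` C by rewrite /A ltnn.
have AG : \bigcap_(i in [set` (n.+1 |` F)%fset]) A i =
    \bigcap_(i in [set` F]) A i `&` Z n.+1 @^-1` C.
  rewrite set_fsetU1 bigcap_setU1 AS setIC//.
rewrite -AF -AG indep//; last first.
  by move=> k; rewrite /= in_fset1U FE => /orP[/eqP ->|]; lia.
rewrite big_fsetU1//= indep ?AS 1?muleC// => k.
by rewrite /= FE => /andP[].
Qed.

Lemma mutually_independent5 d (T : measurableType d) (R : realType)
    (P : probability T R) (G0 G1 G2 G3 G4 : set_system T)
    (A0 A1 A2 A3 A4 : set T) :
  mutually_independent P [set: 'I_5]
    (fun i => nth set0 [:: G0; G1; G2; G3; G4] i) ->
  G0 A0 -> G1 A1 -> G2 A2 -> G3 A3 -> G4 A4 ->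
  P (A0 `&` A1 `&` A2 `&` A3 `&` A4) =
    (P A0 * P A1 * P A2 * P A3 * P A4)%E.
Proof.
move=> indep h0 h1 h2 h3 h4.
pose B := [fset i in enum 'I_5]%fset.
pose A (i : 'I_5) := nth set0 [:: A0; A1; A2; A3; A4] i.
have BE i : i \in B by rewrite !inE mem_enum.
have -> : A0 `&` A1 `&` A2 `&` A3 `&` A4 = \bigcap_(i in [set` B]) A i.
  apply/seteqP; split => w.
    by move=> [[[[? ?] ?] ?] ?] [[|[|[|[|[|//]]]]] hi] _.
  move=> hw; split; [split; [split; [split|]|]|].
  - by have := hw (inord 0) (BE _); rewrite /A inordK.
  - by have := hw (inord 1) (BE _); rewrite /A inordK.
  - by have := hw (inord 2) (BE _); rewrite /A inordK.
  - by have := hw (inord 3) (BE _); rewrite /A inordK.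
  - by have := hw (inord 4) (BE _); rewrite /A inordK.
rewrite indep//; last by move=> [[|[|[|[|[|//]]]]] hi] _.
rewrite (perm_big (index_enum 'I_5)); last first.
  apply: uniq_perm; rewrite ?fset_uniq ?index_enum_uniq// => i.
  by rewrite BE mem_index_enum.
by rewrite /= !big_ord_recl big_ord0 mule1/= !muleA.
Qed.

(** * History and draws of the walk *)

Definition pm1 (R : realType) (b : bool) : R := if b then 1 else -1.

Lemma sum_draws (R : realType) n (F : nat -> bool -> bool -> R) :
  \sum_(t : 'I_n * (bool * bool)) F t.1.+1 t.2.1 t.2.2 =
  \sum_(i < n) (F i.+1 true true + F i.+1 true false +
                (F i.+1 false true + F i.+1 false false)).
Proof.
rewrite -(pair_bigA _ (fun (i : 'I_n) (b : bool * bool) => F i.+1 b.1 b.2))/=.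
apply: eq_bigr => i _.
by rewrite -(pair_bigA _ (fun b c : bool => F i.+1 b c))/= big_bool !big_bool.
Qed.

Section tampered_walk.
Context d (T : measurableType d) (R : realType) (P : probability T R)
  (p lam : R) (D : nat -> {RV P >-> {fset nat}}) (W : tmerw p lam D).

Let X := tm_X W.
Let Y := tm_Y W.
Let eps := tm_eps W.
Let I := tm_I W.

(* Only the bits [Y k w == 1] and [eps k w == 1] are recorded, so that the
   history takes countably many values even off the almost sure event where
   [Y] and [eps] are [+1] or [-1]. *)
Definition history n w : bool * seq {fset nat} * seq bool * seq bool * seq nat :=
  (X 1%N w == 1, [seq D k w | k <- iota 1 n], [seq Y k w == 1 | k <- iota 2 n.-1],
   [seq eps k w == 1 | k <- iota 2 n.-1], [seq I k w | k <- iota 2 n.-1]).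

Definition draw_event n i (y e : bool) : set T :=
  Y n.+1 @^-1` [set pm1 R y] `&` eps n.+1 @^-1` [set pm1 R e] `&`
  I n.+1 @^-1` [set i].

Definition draw_prob n (y e : bool) : R :=
  (if y then lam else 1 - lam) * (if e then p else 1 - p) * n%:R^-1.

(** For [n >= 1] this is the value of [X n.+1] on [draw_event n i y e], expressed through quantities
    known before the draw. *)
Definition draw_value n i (y e : bool) w : R :=
  if i \in D n w then pm1 R y else pm1 R e * X i w.

(** The martingale difference of the walk, expanded over the [4 * n] possible draws as past values
    times centered indicators; [innovation_noiseE] identifies it with [X n.+1] minus its conditional
    mean. *)
Definition innovation_noise n w : R :=
  \sum_(t : 'I_n * (bool * bool)) draw_value n t.1.+1 t.2.1 t.2.2 w *
    (\1_(draw_event n t.1.+1 t.2.1 t.2.2) w - draw_prob n t.2.1 t.2.2).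

Definition noise_walk n w : R := \sum_(1 <= k < n) innovation_noise k w.

Lemma historyE n w w0 : history n w = history n w0 <->
  [/\ (X 1%N w == 1) = (X 1%N w0 == 1),
      forall k, (1 <= k <= n)%N -> D k w = D k w0,
      forall k, (2 <= k <= n)%N -> (Y k w == 1) = (Y k w0 == 1),
      forall k, (2 <= k <= n)%N -> (eps k w == 1) = (eps k w0 == 1) &
      forall k, (2 <= k <= n)%N -> I k w = I k w0].
Proof.
split=> [[hX /eq_in_map hD /eq_in_map hY /eq_in_map he /eq_in_map hI]|].
  by split => // k kn; [apply: hD|apply: hY|apply: he|apply: hI];
    rewrite mem_iota; move: kn; lia.
move=> [hX hD hY he hI]; rewrite /history hX; congr (_, _, _, _, _);
  by apply/eq_in_map => k; rewrite mem_iota => kn; first [apply: hD|apply: hY|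
    apply: he|apply: hI]; move: kn; lia.
Qed.

(** A fiber splits into one event per independent source, the shape required by
    [mutually_independent5]. *)
Lemma history_fiber n w0 : history n @^-1` [set history n w0] =
  X 1%N @^-1` [set r | (r == 1) = (X 1%N w0 == 1)] `&`
  [set w | forall k, (1 <= k <= n)%N -> [set D k w0] (D k w)] `&`
  [set w | forall k, (2 <= k <= n)%N ->
    [set r | (r == 1) = (Y k w0 == 1)] (Y k w)] `&`
  [set w | forall k, (2 <= k <= n)%N ->
    [set r | (r == 1) = (eps k w0 == 1)] (eps k w)] `&`
  [set w | forall k, (2 <= k <= n)%N -> [set I k w0] (I k w)].
Proof.
apply/seteqP; split => w /=; first by move=> /historyE [].
by move=> [[[[? ?] ?] ?] ?]; apply/historyE.
Qed.

Lemma measurable_eq1 (b : bool) : measurable [set r : R | (r == 1) = b].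
Proof.
case: b; first rewrite (_ : [set _ | _] = [set 1])//.
  by apply/seteqP; split => r /= /eqP.
rewrite (_ : [set _ | _] = ~` [set 1]); first exact: measurableC.
by apply/seteqP; split => r /=; [move/eqP|move/eqP/negbTE].
Qed.

Lemma measurable_preimage d' (V : measurableType d') (Z : {RV P >-> V})
  (B : set V) : measurable B -> measurable (Z @^-1` B).
Proof. by move=> mB; rewrite -[X in measurable X]setTI; exact: measurable_funP. Qed.

Lemma measurable_forall_preimage d' (V : measurableType d')
    (Z : nat -> {RV P >-> V}) m n (B : nat -> set V) :
  (forall k, measurable (B k)) ->
  measurable [set w | forall k, (m <= k <= n)%N -> B k (Z k w)].
Proof.
move=> mB; pose J := [set k | (m <= k <= n)%N].
rewrite (_ : [set w | _] = \bigcap_k (if k \in J then Z k @^-1` B k else setT)).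
  apply: bigcapT_measurable => k.
  by case: ifP => _ //; exact: measurable_preimage.
apply/seteqP; split => w /= hw k.
  by move=> _; case: ifPn => [/set_mem/hw|].
by move=> Jk; have := hw k Logic.I; rewrite mem_set.
Qed.

Lemma measurable_history_fiber n v : measurable (history n @^-1` [set v]).
Proof.
have [[w0 <-]|h] := pselect (exists w0, history n w0 = v); last first.
  rewrite (_ : _ @^-1` _ = set0); first exact: measurable0.
  by apply/seteqP; split => // w /= wv; apply: h; exists w.
rewrite history_fiber.
apply: measurableI;
  [apply: measurableI; [apply: measurableI; [apply: measurableI|]|]|].
- by apply: measurable_preimage; exact: measurable_eq1.
- exact: (@measurable_forall_preimage _ _ D _ _ (fun k => [set D k w0])).
- apply: (@measurable_forall_preimage _ _ Y _ _
    (fun k => [set r : R | (r == 1) = (Y k w0 == 1)])) => k.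
  exact: measurable_eq1.
- apply: (@measurable_forall_preimage _ _ eps _ _
    (fun k => [set r : R | (r == 1) = (eps k w0 == 1)])) => k.
  exact: measurable_eq1.
- exact: (@measurable_forall_preimage _ _ I _ _ (fun k => [set I k w0])).
Qed.

Lemma measurable_draw_event n i y e : measurable (draw_event n i y e).
Proof.
by apply: measurableI; [apply: measurableI|]; exact: measurable_preimage.
Qed.

(** Independence across the five sources separates them; independence within [Y], [eps] and [I] then
    splits off time [n.+1]. The memory sets may depend on each other arbitrarily, as they enter only
    through the single factor [P HD]. *)
Lemma draw_event_indep n i y e v : (1 <= i <= n)%N ->
  P (draw_event n i y e `&` history n @^-1` [set v]) =
  ((draw_prob n y e)%:E * P (history n @^-1` [set v]))%E.
Proof.
move=> iN; have n1 : (1 <= n)%N by move: iN; lia.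
have [[w0 <-]|h] := pselect (exists w0, history n w0 = v); last first.
  rewrite (_ : history n @^-1` _ = set0) ?setI0 ?measure0 ?mule0//.
  by apply/seteqP; split => // w /= wv; apply: h; exists w.
pose BX := [set r : R | (r == 1) = (X 1%N w0 == 1)].
pose BD k := [set D k w0]; pose BI k := [set I k w0].
pose BY k := [set r : R | (r == 1) = (Y k w0 == 1)].
pose Be k := [set r : R | (r == 1) = (eps k w0 == 1)].
pose HX := X 1%N @^-1` BX.
pose HD := [set w | forall k, (1 <= k <= n)%N -> BD k (D k w)].
pose HY := [set w | forall k, (2 <= k <= n)%N -> BY k (Y k w)].
pose He := [set w | forall k, (2 <= k <= n)%N -> Be k (eps k w)].
pose HI := [set w | forall k, (2 <= k <= n)%N -> BI k (I k w)].
have -> : history n @^-1` [set history n w0] = HX `&` HD `&` HY `&` He `&` HI.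
  exact: history_fiber.
have mX : measurable BX by exact: measurable_eq1.
have mD k : measurable (BD k) by [].
have mY k : measurable (BY k) by exact: measurable_eq1.
have me k : measurable (Be k) by exact: measurable_eq1.
have mI k : measurable (BI k) by [].
have sX : sigma_gen [set 1%N] X HX by exact: sigma_gen_preimage.
have sD : sigma_gen [set k | (1 <= k)%N] D HD.
  by apply: (@sigma_gen_forall _ _ _ _ _ _ _ BD) => // k /andP[].
have sub2 : [set k | (2 <= k <= n)%N] `<=` [set k | (2 <= k)%N].
  by move=> k /andP[].
have sY : sigma_gen [set k | (2 <= k)%N] Y HY.
  exact: (@sigma_gen_forall _ _ _ _ _ _ _ BY).
have se : sigma_gen [set k | (2 <= k)%N] eps He.
  exact: (@sigma_gen_forall _ _ _ _ _ _ _ Be).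
have sI : sigma_gen [set k | (2 <= k)%N] I HI.
  exact: (@sigma_gen_forall _ _ _ _ _ _ _ BI).
rewrite /draw_event; set AY := Y n.+1 @^-1` _; set Ae := eps n.+1 @^-1` _.
set AI := I n.+1 @^-1` _.
have sAY : sigma_gen [set k | (2 <= k)%N] Y AY by exact: sigma_gen_preimage.
have sAe : sigma_gen [set k | (2 <= k)%N] eps Ae by exact: sigma_gen_preimage.
have sAI : sigma_gen [set k | (2 <= k)%N] I AI by exact: sigma_gen_preimage.
(* Each new draw is grouped with the past of its own source. *)
have -> : AY `&` Ae `&` AI `&` (HX `&` HD `&` HY `&` He `&` HI) =
    HX `&` HD `&` (HY `&` AY) `&` (He `&` Ae) `&` (HI `&` AI).
  by apply/seteqP; split => w /=; tauto.
rewrite (mutually_independent5 (@tm_all_indep _ _ _ _ _ _ _ W) sX sD (sigma_gen_setI sY sAY)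
  (sigma_gen_setI se sAe) (sigma_gen_setI sI sAI)).
rewrite (mutually_independent5 (@tm_all_indep _ _ _ _ _ _ _ W) sX sD sY se sI).
rewrite (@independent_seq_next _ _ _ _ _ _ _ BY _ n (@tm_Y_indep _ _ _ _ _ _ _ W))//.
rewrite (@independent_seq_next _ _ _ _ _ _ _ Be _ n (@tm_eps_indep _ _ _ _ _ _ _ W))//.
rewrite (@independent_seq_next _ _ _ _ _ _ _ BI _ n (@tm_I_indep _ _ _ _ _ _ _ W))//.
have -> : P AY = (if y then lam else 1 - lam)%:E.
  by have [h1 h2] := @tm_Y_law _ _ _ _ _ _ _ W n.+1 n1; rewrite /AY; case: (y).
have -> : P Ae = (if e then p else 1 - p)%:E.
  by have [h1 h2] := @tm_eps_law _ _ _ _ _ _ _ W n.+1 n1; rewrite /Ae; case: (e).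
have -> : P AI = (n%:R^-1)%:E by exact: (@tm_I_law _ _ _ _ _ _ _ W _ _ iN).
have finP B : measurable B -> exists r : R, P B = r%:E.
  by move=> mB; exists (fine (P B)); rewrite fineK// fin_num_measure.
have [rX ->] : exists r : R, P HX = r%:E by apply: finP; exact: measurable_preimage.
have [rD ->] : exists r : R, P HD = r%:E.
  by apply: finP; exact: (@measurable_forall_preimage _ _ _ _ _ BD).
have [rY ->] : exists r : R, P HY = r%:E.
  by apply: finP; exact: (@measurable_forall_preimage _ _ _ _ _ BY).
have [re ->] : exists r : R, P He = r%:E.
  by apply: finP; exact: (@measurable_forall_preimage _ _ _ _ _ Be).
have [rI ->] : exists r : R, P HI = r%:E.
  by apply: finP; exact: (@measurable_forall_preimage _ _ _ _ _ BI).
by rewrite -!EFinM /draw_prob; congr EFin; ring.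
Qed.

(** * Almost sure signs, and dependence on the history *)

Lemma N1_eq1F : (-1 == 1 :> R) = false.
Proof. by rewrite lt_eqF// (lt_trans (ltrN10 R) ltr01). Qed.

(** The laws fix the values of [Y] and [eps] only almost surely; on this event the bits kept in
    [history] determine them. *)
Definition signs_pm1 w := forall k, (2 <= k)%N ->
  (Y k w = 1 \/ Y k w = -1) /\ (eps k w = 1 \/ eps k w = -1).

Lemma ae_pm1 (Z : {RV P >-> R}) (r : R) :
  P [set w | Z w = 1] = r%:E -> P [set w | Z w = -1] = (1 - r)%:E ->
  {ae P, forall w, Z w = 1 \/ Z w = -1}.
Proof.
pose A := [set w | Z w = 1]; pose B := [set w | Z w = -1] => hA hB.
have mA : measurable A by exact: (measurable_preimage Z (measurable_set1 1)).
have mB : measurable B by exact: (measurable_preimage Z (measurable_set1 (-1))).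
have PU : P (A `|` B) = (P A + P B)%E.
  apply: measureU => //.
  by apply/seteqP; split => // w [Aw Bw]; move: Aw; rewrite /A/= Bw => /eqP; rewrite N1_eq1F.
exists (~` (A `|` B)); split => //; first by apply: measurableC; exact: measurableU.
rewrite probability_setC; last exact: measurableU.
by rewrite PU hA hB -EFinD; congr EFin; ring.
Qed.

Lemma signs_pm1_ae : {ae P, forall w, signs_pm1 w}.
Proof.
apply: ae_foralln => -[|[|k]]; [exact: aeW|exact: aeW|].
have [h1 h2] := @tm_Y_law _ _ _ _ _ _ _ W k.+2 isT.
have [h3 h4] := @tm_eps_law _ _ _ _ _ _ _ W k.+2 isT.
by move: (ae_pm1 h3 h4); move: (ae_pm1 h1 h2); apply: filterS2.
Qed.

(** Integration requires a measurable domain, whereas the almost sure statement only places the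
    exceptional points inside a measurable null set; [Om] is the complement of that null set. *)
Lemma signs_pm1_event : exists Om : set T,
  [/\ measurable Om, forall B, measurable B -> P (Om `&` B) = P B &
      Om `<=` signs_pm1].
Proof.
have [N [mN PN NE]] := signs_pm1_ae.
exists (~` N); split; first exact: measurableC.
- move=> B mB; have PBN : P (B `&` N) = 0%E.
    apply/eqP; rewrite eq_le measure_ge0 andbT -PN le_measure// inE//.
    exact: measurableI.
  by have -> := measureDI P mB mN; rewrite [X in (_ + X)%E]PBN adde0 setIC setDE.
- by move=> w Nw; apply: contrapT => h; apply: Nw; exact: NE.
Qed.

Lemma history_le m n w w' : (m <= n)%N ->
  history n w = history n w' -> history m w = history m w'.
Proof.
move=> mn /historyE[h1 h2 h3 h4 h5]; apply/historyE.
by split => // k km; [apply: h2|apply: h3|apply: h4|apply: h5]; lia.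
Qed.

Lemma pm1_inj (a b : R) : a = 1 \/ a = -1 -> b = 1 \/ b = -1 ->
  (a == 1) = (b == 1) -> a = b.
Proof.
by move=> [->|->] [->|->]; rewrite ?eqxx ?N1_eq1F.
Qed.

Lemma X_pm1 w k : signs_pm1 w -> (1 <= k)%N -> X k w = 1 \/ X k w = -1.
Proof.
move=> gw; elim/ltn_ind: k => -[|[|k]] // IH _; first exact: tm_X1_pm1.
rewrite /X (tm_X_step W)//.
have [hY he] := gw k.+2 isT.
case: ifPn => _; first exact: hY.
have /andP[I1 I2] := @tm_I_range _ _ _ _ _ _ _ W k.+1 w isT.
have : X (tm_I W k.+2 w) w = 1 \/ X (tm_I W k.+2 w) w = -1 by exact: IH.
case: he; rewrite /eps /X => -> [->|->];
  by rewrite ?mul1r ?mulN1r ?opprK; first [by left|by right].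
Qed.

Lemma X_le1 w k : signs_pm1 w -> (1 <= k)%N -> `|X k w| <= 1.
Proof. by move=> gw k1; case: (X_pm1 gw k1) => ->; rewrite ?normrN normr1. Qed.

(** When all signs are [1] or [-1], the recorded bits give back [Y] and [eps], and the recursion
    rebuilds [X] by strong induction, since [I k] points to an earlier time. *)
Lemma X_history n w w' k : signs_pm1 w -> signs_pm1 w' ->
  history n w = history n w' -> (1 <= k <= n)%N -> X k w = X k w'.
Proof.
move=> gw gw' /historyE[hX hD hY he hI].
elim/ltn_ind: k => -[|[|k]] // IH kn.
  by apply: pm1_inj => //; exact: tm_X1_pm1.
rewrite /X !(tm_X_step W)//.
have kn2 : (2 <= k.+2 <= n)%N by lia.
have [gY ge] := gw k.+2 isT; have [gY' ge'] := gw' k.+2 isT.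
have -> : tm_I W k.+2 w = tm_I W k.+2 w' by exact: hI.
have -> : D k.+1 w = D k.+1 w' by apply: hD; lia.
have -> : tm_Y W k.+2 w = tm_Y W k.+2 w' by apply: pm1_inj => //; exact: hY.
have -> : tm_eps W k.+2 w = tm_eps W k.+2 w' by apply: pm1_inj => //; exact: he.
case: ifP => // _; congr (_ * _).
have /andP[I1 I2] := @tm_I_range _ _ _ _ _ _ _ W k.+1 w' isT.
by apply: IH; lia.
Qed.

Lemma draw_value_history n i y e w w' : signs_pm1 w -> signs_pm1 w' ->
  history n w = history n w' -> (1 <= i <= n)%N ->
  draw_value n i y e w = draw_value n i y e w'.
Proof.
move=> gw gw' h iN; rewrite /draw_value (X_history gw gw' h iN).
by case/historyE : h => _ -> //; lia.
Qed.

(** The history at [n.+1] is required because the indicators look at the draw made at that time.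
    Summing up to [n - 1], [noise_walk n] then depends on the history at [n] alone. *)
Lemma innovation_noise_history n w w' : signs_pm1 w -> signs_pm1 w' ->
  history n.+1 w = history n.+1 w' ->
  innovation_noise n w = innovation_noise n w'.
Proof.
move=> gw gw' h; apply: eq_bigr => -[i [y e]] _ /=.
have n1 : (1 <= n)%N by apply: leq_ltn_trans (ltn_ord i).
rewrite (draw_value_history y e gw gw' (history_le (leqnSn n) h)) ?ltn_ord//.
congr (_ * (_ - _)); case/historyE : h => _ _ hY he hI.
have [gY ge] := gw n.+1 n1; have [gY' ge'] := gw' n.+1 n1.
have nn : (2 <= n.+1 <= n.+1)%N by lia.
have eY : Y n.+1 w = Y n.+1 w' by apply: pm1_inj => //; exact: hY.
have ee : eps n.+1 w = eps n.+1 w' by apply: pm1_inj => //; exact: he.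
rewrite !indicE; congr (nat_of_bool _)%:R.
by apply/idP/idP; rewrite !inE /draw_event /= eY ee hI.
Qed.

Lemma noise_walk_history n w w' : signs_pm1 w -> signs_pm1 w' ->
  history n w = history n w' -> noise_walk n w = noise_walk n w'.
Proof.
move=> gw gw' h; rewrite /noise_walk !big_nat; apply: eq_bigr => k kn.
by apply: innovation_noise_history => //; apply: history_le h; lia.
Qed.

(** The mean of [X n.+1] given the past and the memory sets: an index in [D n] contributes the mean
    of an innovation, any other the mean of [eps] times the remembered step. *)
Definition drift n w : R := n%:R^-1 *
  \sum_(i < n) (if i.+1 \in D n w then 2 * lam - 1 else (2 * p - 1) * X i.+1 w).

(** Exactly one of the draws occurs, which leaves [X n.+1] from the indicators; the weights
    [draw_prob] add up to the drift. *)
Lemma innovation_noiseE n w : signs_pm1 w -> (1 <= n)%N ->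
  innovation_noise n w = X n.+1 w - drift n w.
Proof.
move=> gw n1; rewrite /innovation_noise.
under eq_bigr do rewrite mulrBr.
rewrite sumrB; congr (_ - _); last first.
  rewrite (sum_draws n (fun i y e => draw_value n i y e w * draw_prob n y e)).
  rewrite /drift mulr_sumr; apply: eq_bigr => i _.
  by rewrite /draw_value /draw_prob /pm1; case: ifP => _; ring.
have /andP[I1 I2] := @tm_I_range _ _ _ _ _ _ _ W n w n1.
have i0P : ((tm_I W n.+1 w).-1 < n)%N by lia.
have [gY ge] := gw n.+1 n1.
have YE : pm1 R (Y n.+1 w == 1) = Y n.+1 w by case: gY => ->; rewrite ?eqxx ?N1_eq1F.
have eE : pm1 R (eps n.+1 w == 1) = eps n.+1 w.
  by case: ge => ->; rewrite ?eqxx ?N1_eq1F.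
rewrite (bigD1 (Ordinal i0P, (Y n.+1 w == 1, eps n.+1 w == 1)))//= prednK//.
rewrite big1 ?addr0; last first.
  move=> [i [y e]] /= ne; rewrite indicE memNset ?mulr0// => -[[hY he] hI].
  move/eqP : ne; apply; congr (_, (_, _)).
  - by apply: val_inj => /=; rewrite -[tm_I W _ _]/(I n.+1 w) hI.
  - by rewrite hY; case: (y); rewrite /pm1 ?eqxx ?N1_eq1F.
  - by rewrite he; case: (e); rewrite /pm1 ?eqxx ?N1_eq1F.
rewrite indicE mem_set ?mulr1; last by split; [split|]; rewrite /= ?YE ?eE.
by rewrite /draw_value YE eE [RHS](tm_X_step W).
Qed.

(** * Bounds and strong law for the noise *)

Context (hp : 0 <= p <= 1) (hlam : 0 <= lam <= 1).

Lemma tampered_term_le1 n w i : signs_pm1 w -> (1 <= i)%N ->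
  `|if i \in D n w then 2 * lam - 1 else (2 * p - 1) * X i w| <= 1.
Proof.
move=> gw i1; move: hp hlam => /andP[p0 p1] /andP[l0 l1].
case: ifP => _; first by rewrite ler_norml; lra.
rewrite normrM -[leRHS]mul1r ler_pM ?X_le1// ler_norml; lra.
Qed.

Lemma drift_le1 n w : signs_pm1 w -> (1 <= n)%N -> `|drift n w| <= 1.
Proof.
move=> gw n1; have n0 : 0 < n%:R :> R by rewrite ltr0n.
rewrite /drift normrM ger0_norm ?invr_ge0// mulrC ler_pdivrMr// mul1r.
apply: le_trans (ler_norm_sum _ _ _) _.
rewrite -[leRHS](_ : \sum_(i < n) 1 = n%:R); last by rewrite sumr_const card_ord.
by apply: ler_sum => i _; exact: tampered_term_le1.
Qed.

Lemma innovation_noise_le2 n w : signs_pm1 w -> (1 <= n)%N ->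
  `|innovation_noise n w| <= 2.
Proof.
move=> gw n1; rewrite innovation_noiseE// (le_trans (ler_normB _ _))//.
by rewrite -[leRHS]/(1 + 1 : R) lerD ?X_le1 ?drift_le1.
Qed.

Lemma noise_walkS n w : (1 <= n)%N ->
  noise_walk n.+1 w = noise_walk n w + innovation_noise n w.
Proof. by move=> n1; rewrite /noise_walk big_nat_recr. Qed.

Lemma noise_walk_le n w : signs_pm1 w -> `|noise_walk n w| <= 2 * n%:R.
Proof.
move=> gw; elim: n => [|[|n] IH].
- by rewrite /noise_walk big_geq// normr0 mulr0.
- by rewrite /noise_walk big_geq// normr0.
- rewrite noise_walkS// -[n.+2%:R]natr1 mulrDr mulr1.
  by rewrite (le_trans (ler_normD _ _))// lerD// innovation_noise_le2.
Qed.

Lemma measurable_draw_value n i y e : measurable_fun setT (draw_value n i y e).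
Proof.
apply: measurable_fun_ifT.
- apply: (@measurable_fun_bool _ _ _ _ true).
  rewrite setTI; exact: (@measurable_preimage _ _ (D n) [set A : {fset nat} | i \in A]).
- exact: measurable_cst.
- by apply: measurable_funM => //; exact: measurable_funP.
Qed.

Lemma measurable_innovation_noise n : measurable_fun setT (innovation_noise n).
Proof.
apply: measurable_sum => t; apply: measurable_funM; first exact: measurable_draw_value.
apply: measurable_funB => //.
by apply: measurable_indic; exact: measurable_draw_event.
Qed.

Lemma measurable_noise_walk n : measurable_fun setT (noise_walk n).
Proof. by apply: measurable_sum => k; exact: measurable_innovation_noise. Qed.

(** After expansion over the draws, each term is a bounded function of the history times the
    centered indicator of an event independent of that history. *)
Lemma noise_walk_orthogonal (Om : set T) n : measurable Om ->
  (forall B, measurable B -> P (Om `&` B) = P B) -> Om `<=` signs_pm1 ->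
  (1 <= n)%N ->
  (\int[P]_(w in Om) (noise_walk n w * innovation_noise n w)%:E = 0)%E.
Proof.
move=> mOm POm gOm n1.
pose Z (t : 'I_n * (bool * bool)) w :=
  noise_walk n w * draw_value n t.1.+1 t.2.1 t.2.2 w.
pose C (t : 'I_n * (bool * bool)) w :=
  \1_(draw_event n t.1.+1 t.2.1 t.2.2) w - draw_prob n t.2.1 t.2.2.
have mZ t : measurable_fun Om (Z t).
  apply: measurable_funM; apply: measurable_funTS;
    [exact: measurable_noise_walk|exact: measurable_draw_value].
have mC t : measurable_fun Om (C t).
  by apply: measurable_funB => //; apply: measurable_indic;
    exact: measurable_draw_event.
have ZM t w : Om w -> `|Z t w| <= 2 * n%:R.
  move=> /gOm gw; rewrite /Z normrM -[leRHS]mulr1 ler_pM ?noise_walk_le//.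
  rewrite /draw_value /pm1; case: ifP => _.
    by case: ifP => _; rewrite ?normrN normr1.
  rewrite normrM -[leRHS]mulr1 ler_pM ?X_le1//.
  by case: ifP => _; rewrite ?normrN normr1.
have CM t w : `|C t w| <= 1 + `|draw_prob n t.2.1 t.2.2|.
  apply: le_trans (ler_normB _ _) _; rewrite lerD2r indicE.
  by case: (w \in _); rewrite ?normr1 ?normr0.
under eq_integral do rewrite /innovation_noise mulr_sumr -sumEFin.
under eq_integral do under eq_bigr do rewrite mulrA.
rewrite (@integral_sum _ _ _ P Om mOm _ (fun t w => (Z t w * C t w)%:E)); last first.
  move=> t; apply: (@bounded_integrable _ _ _ _ _ (fun w => Z t w * C t w)
    (2 * n%:R * (1 + `|draw_prob n t.2.1 t.2.2|))) => //.
    exact: measurable_funM.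
  by move=> w Ow; rewrite normrM ler_pM ?ZM ?CM.
apply: big1 => -[i [y e]] _.
apply: (@integral_centered_indep _ _ _ _ _ _ _ (history n) _ _ (2 * n%:R)) => //.
- exact: measurable_draw_event.
- exact: measurable_history_fiber.
- exact: ZM.
- move=> w w' Ow Ow' h; rewrite /Z (noise_walk_history (gOm _ Ow) (gOm _ Ow') h).
  by rewrite (draw_value_history y e (gOm _ Ow) (gOm _ Ow') h)/= ?ltn_ord.
(* [Om] has full probability and drops out of both sides. *)
- move=> v; rewrite setICA !POm.
  + by apply: draw_event_indep => /=.
  + exact: measurable_history_fiber.
  + by apply: measurableI; [exact: measurable_draw_event|exact: measurable_history_fiber].
Qed.

Lemma noise_walk_slln :
  {ae P, forall w, (fun n => noise_walk n w / n%:R) @ \oo --> (0 : R)}.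
Proof.
have [Om [mOm POm gOm]] := signs_pm1_event.
have mN n : measurable_fun Om (noise_walk n).
  by apply: measurable_funTS; exact: measurable_noise_walk.
have incr n w : Om w -> `|noise_walk n.+1 w - noise_walk n w| <= 2.
  (* [noise_walk] is an empty sum at times 0 and 1, so the first increment is 0. *)
  case: n => [|n] Ow; first by rewrite /noise_walk !big_geq// subrr normr0.
  by rewrite noise_walkS// addrAC subrr add0r innovation_noise_le2//; exact: gOm.
have orth n : (\int[P]_(w in Om)
    (noise_walk n w * (noise_walk n.+1 w - noise_walk n w))%:E = 0)%E.
  case: n => [|n].
    by rewrite integral0_eq// => w _; rewrite /noise_walk big_geq// mul0r.
  under eq_integral do rewrite (noise_walkS _ (ltn0Sn n)) addrAC subrr add0r.
  exact: noise_walk_orthogonal.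
have N0 w : noise_walk 0 w = 0 by rewrite /noise_walk big_geq.
have m2 := orthogonal_increments_second_moment mOm mN N0 incr orth.
have slln := linear_second_moment_slln mOm mN incr m2.
have OmT : {ae P, forall w, Om w}.
  exists (~` Om); split => //; first exact: measurableC.
  rewrite -(POm (~` Om)) ?setICr ?measure0//; exact: measurableC.
by move: OmT slln; apply: filterS2 => w Ow; exact.
Qed.

(** * Effect of the memory sets, and conclusion *)

(** Terms with index outside [D n] cancel, and each index in [D n] leaves a difference of two
    numbers bounded by 1. *)
Lemma tampered_remainder n w : signs_pm1 w -> (1 <= n)%N ->
  `|drift n w - (2 * p - 1) * (tmerw_walk W n w / n%:R)| <=
  2 * (#|` D n w|%:R / n%:R).
Proof.
move=> gw n1; move: hp hlam => /andP[p0 p1] /andP[l0 l1].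
have n0 : 0 < n%:R :> R by rewrite ltr0n.
have -> : tmerw_walk W n w = \sum_(i < n) X i.+1 w.
  by rewrite /tmerw_walk big_add1/= big_mkord.
have -> : drift n w - (2 * p - 1) * ((\sum_(i < n) X i.+1 w) / n%:R) =
    (\sum_(i < n) (if i.+1 \in D n w then 2 * lam - 1 - (2 * p - 1) * X i.+1 w
                   else 0)) / n%:R.
  rewrite /drift mulrA [n%:R^-1 * _]mulrC -mulrBl mulr_sumr -sumrB.
  by congr (_ / _); apply: eq_bigr => i _; case: ifP => _ //; rewrite subrr.
rewrite normrM normfV (gtr0_norm n0) mulrA ler_pM2r ?invr_gt0//.
apply: le_trans (ler_norm_sum _ _ _) _.
apply: (@le_trans _ _ (\sum_(i < n) 2 * (i.+1 \in D n w)%:R)).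
  apply: ler_sum => i _; case: ifP => _; last by rewrite normr0 mulr0.
  rewrite mulr1 (le_trans (ler_normB _ _))// -[leRHS]/(1 + 1 : R) lerD//.
    by rewrite ler_norml; lra.
  rewrite normrM -[leRHS]mul1r ler_pM ?X_le1// ler_norml; lra.
rewrite -mulr_sumr ler_pM2l// -natr_sum ler_nat.
(* The sum counts distinct elements of [D n], hence is at most its cardinality. *)
have -> : (\sum_(i < n) (i.+1 \in D n w) = count (mem (D n w)) (iota 1 n))%N.
  have -> : iota 1 n = index_iota 1 n.+1 by rewrite /index_iota subn1.
  rewrite -sum1_count [RHS]big_mkcond/=.
  by rewrite big_add1/= big_mkord; apply: eq_bigr => i _; case: ifP.
rewrite -size_filter; apply: uniq_leq_size; first by rewrite filter_uniq ?iota_uniq.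
by move=> k; rewrite mem_filter => /andP[].
Qed.

End tampered_walk.

Theorem theorem1p6 (d : measure_display) (T : measurableType d) (R : realType)
    (P : probability T R) (p lam : R) (D : nat -> {RV P >-> {fset nat}})
    (W : tmerw p lam D) (hp : 0 <= p < 1) (hlam : 0 <= lam <= 1)
    (hD : {ae P, forall w,
      (fun n : nat => #|` D n w|%:R / n%:R : R) @ \oo --> (0 : R)}) :
  {ae P, forall w,
    (fun n : nat => tmerw_walk W n w / n%:R) @ \oo --> (0 : R)}.
Proof.
have /andP[p0 p1] := hp.
have hp' : 0 <= p <= 1 by rewrite p0 ltW.
have signs := signs_pm1_ae W.
have slln := noise_walk_slln W hp' hlam.
move: signs hD slln; apply: filterS3 => w gw hDw hN.
pose r n := drift W n w - (2 * p - 1) * (tmerw_walk W n w / n%:R).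
apply: (@tampered_recursion_cvg0 _ (2 * p - 1) _
  (fun n => noise_walk W n w) r) => //.
(* Here [p < 1] gives the strict inequality [2 * p - 1 < 1]. *)
- by apply/andP; split; lra.
- move=> n n1; rewrite noise_walkS// innovation_noiseE// /r.
  by rewrite [LHS]big_nat_recr//=; rewrite -/(tmerw_walk W n w); ring.
- apply/norm_cvg0P; apply: (@squeeze_cvgr _ _ _ _ (fun=> 0)
    (fun n => 2 * (#|` D n w|%:R / n%:R))).
  + near=> n; rewrite normr_ge0/=; apply: tampered_remainder => //.
    by near: n; exists 1%N.
  + exact: cvg_cst.
  + by rewrite -[X in _ --> X](mulr0 2); exact: cvgMr.
Unshelve. all: by end_near.
Qed.
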